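(* Let $\mathcal G$ be a Markov $\alpha$-potential game with $\alpha$-potential function $\Phi$, stage payoffs $u_i(s,a)\in[0,1]$, and initial distribution $\mu\in\Delta(S)$. Let $C_\Phi>0$ satisfy $|\Phi(\mu',\pi)-\Phi(\mu',\pi')|\le C_\Phi$ for all $\pi,\pi'\in\Pi$, $\mu'\in\Delta(S)$, and let $\tilde\kappa_\mu=\min_{\nu\in\Delta(S)}\max_{\pi\in\Pi}\|d_\mu^\pi/\nu\|_\infty<\infty$. Then the projected gradient-ascent algorithm run for $T$ steps with step size $$\eta=\frac{(1-\delta)^{2.5}\sqrt{C_\Phi+|I|^2\alpha T}}{2|I|\bar A\sqrt T}$$ satisfies $$\text{Nash-regret}(T)\le\mathcal O\Big(\frac{\sqrt{\tilde\kappa_\mu\bar A|I|}}{(1-\delta)^{9/4}}\Big(\frac{C_\Phi}{T}+|I|^2\alpha\Big)^{1/4}\Big).$$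
   Context: Markov game $\langle I,S,(A_i),(u_i),P,\delta\rangle$ with finite $I,S,A_i$, $\delta\in(0,1)$; $\bar A=\max_i|A_i|$. Stationary policies $\pi_i$ with $\pi_i(s)\in\Delta(A_i)$, sets $\Pi_i$, $\Pi$, $\Pi_{-i}$; $\pi_{-i}(s,a_{-i})=\prod_{j\ne i}\pi_j(s,a_j)$. $V_i(\mu,\pi)=\mathbb E[\sum_k\delta^k u_i(s^k,a^k)]$ with $s^0\sim\mu$, $a^k\sim\pi(s^k)$, $s^{k+1}\sim P(\cdot|s^k,a^k)$; $V_i(s,\pi)$ for initial state $s$. Markov $\alpha$-potential game: exists $\Phi:S\times\Pi\to\mathbb R$ with $|(\Phi(s,\pi_i',\pi_{-i})-\Phi(s,\pi_i,\pi_{-i}))-(V_i(s,\pi_i',\pi_{-i})-V_i(s,\pi_i,\pi_{-i}))|\le\alpha$ for all $s,i,\pi_i,\pi_i',\pi_{-i}$; $\Phi(\mu,\pi)=\sum_s\mu(s)\Phi(s,\pi)$. $d_\mu^\pi(s)=(1-\delta)\sum_{k\ge0}\delta^k\Pr(s^k=s\mid s^0\sim\mu)$. $Q_i(s,a_i;\pi)=\sum_{a_{-i}}\pi_{-i}(s,a_{-i})\big(u_i(s,a)+\delta\sum_{s'}P(s'|s,a)V_i(s',\pi)\big)$, $Q_i(s;\pi)$ the vector over $a_i$. Projected gradient-ascent algorithm: $\pi_i^{(0)}(s,a_i)=1/|A_i|$ and $\pi_i^{(t+1)}(s)=\mathcal P_{\Delta(A_i)}(\pi_i^{(t)}(s)+\eta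 Q_i(s;\pi^{(t)}))$ for all $i,s$ (Euclidean projection onto the simplex). Nash-regret: $\text{Nash-regret}(T)=\frac1T\sum_{t=1}^T\max_{i\in I}\big(\max_{\pi_i'\in\Pi_i}V_i(\mu,\pi_i',\pi_{-i}^{(t)})-V_i(\mu,\pi^{(t)})\big)$. *)

(* Defs.v *)
From HB Require Import structures.
From mathcomp Require Import all_boot all_order all_algebra.
From mathcomp Require Import all_classical all_reals all_analysis.
Set Implicit Arguments. Unset Strict Implicit. Unset Printing Implicit Defensive.
Import Order.TTheory GRing.Theory Num.Theory.
Local Open Scope ring_scope.

Section MarkovGame.
Variables (R : realType) (I S : finType) (A : I -> finType).

Definition jact := {dffun forall i : I, A i}.

Definition pol := forall i : I, S -> A i -> R.

Definition is_distr (T : finType) (p : T -> R) :=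
  (forall x, 0 <= p x) /\ \sum_x p x = 1.

Definition is_pol_i (i : I) (pi_i : S -> A i -> R) := forall s, is_distr (pi_i s).
Definition is_pol (pi : pol) := forall i, is_pol_i (pi i).

Definition dev (pi : pol) (i : I) (pi_i : S -> A i -> R) : pol :=
  @dfwith I (fun j => S -> A j -> R) pi i pi_i.

Definition jpol (pi : pol) (s : S) (a : jact) : R := \prod_i pi i s (a i).

(* pi_{-i}(s,a_{-i}) = prod_{j <> i} pi_j(s,a_j), viewed as a function of the
   joint action a (it does not depend on a i) *)
Definition mpol (pi : pol) (i : I) (s : S) (a : jact) : R :=
  \prod_(j | j != i) pi j s (a j).

Variables (P : S -> jact -> S -> R) (* P s a s' = P(s'|s,a) *)
          (delta : R).

Fixpoint stprob (mu : S -> R) (pi : pol) (k : nat) (s' : S) : R :=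
  match k with
  | 0 => mu s'
  | k.+1 => \sum_s stprob mu pi k s * \sum_a jpol pi s a * P s a s'
  end.

Definition Val (u : I -> S -> jact -> R) (i : I) (mu : S -> R) (pi : pol) : R :=
  limn (fun n => \sum_(0 <= k < n)
          delta ^+ k * \sum_s stprob mu pi k s * \sum_a jpol pi s a * u i s a).

Definition dirac (s : S) : S -> R := fun s' => (s' == s)%:R.

Definition occ (mu : S -> R) (pi : pol) (s : S) : R :=
  (1 - delta) * limn (fun n => \sum_(0 <= k < n) delta ^+ k * stprob mu pi k s).

Definition Qf (u : I -> S -> jact -> R) (i : I) (pi : pol) (s : S) (ai : A i) : R :=
  \sum_(a : jact | a i == ai)
     mpol pi i s a * (u i s a + delta * \sum_s' P s a s' * Val u i (dirac s') pi).

(* || d / nu ||_oo = max_s d(s)/nu(s), in the extended reals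
   (convention: x/0 = +oo for x > 0 and 0/0 = 0) *)
Definition ratio_inf_norm (d nu : S -> R) : \bar R :=
  \big[Order.max/0%E]_s
     (if nu s == 0 then (if d s == 0 then 0%E else +oo%E) else (d s / nu s)%:E).

Definition kappa_tilde (mu : S -> R) : \bar R :=
  ereal_inf [set ereal_sup [set ratio_inf_norm (occ mu pi) nu | pi in is_pol]
            | nu in [set nu | is_distr nu]].

Definition is_alpha_potential (u : I -> S -> jact -> R) (alpha : R)
  (Phi : S -> pol -> R) :=
  forall (s : S) (i : I) (pi : pol) (pi_i' : S -> A i -> R),
    is_pol pi -> is_pol_i pi_i' ->
    `| (Phi s (dev pi pi_i') - Phi s pi)
       - (Val u i (dirac s) (dev pi pi_i') - Val u i (dirac s) pi) | <= alpha.

Definition Phimu (Phi : S -> pol -> R) (mu : S -> R) (pi : pol) : R :=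
  \sum_s mu s * Phi s pi.

Definition is_simplex_proj (T : finType) (y q : T -> R) :=
  is_distr q /\
  forall q' : T -> R, is_distr q' ->
    \sum_x (q x - y x) ^+ 2 <= \sum_x (q' x - y x) ^+ 2.

Definition is_PGA (u : I -> S -> jact -> R) (eta : R) (pit : nat -> pol) :=
  (forall i s a, pit 0%N i s a = 1 / #|A i|%:R) /\
  (forall t i s, is_simplex_proj
     (fun ai => pit t i s ai + eta * Qf u (pit t) s ai) (pit t.+1 i s)).

Definition nash_regret (u : I -> S -> jact -> R) (mu : S -> R)
  (pit : nat -> pol) (T : nat) : R :=
  T%:R^-1 * \sum_(1 <= t < T.+1)
    \big[Num.max/0]_i
      (sup [set Val u i mu (dev (pit t) pi_i') | pi_i' in @is_pol_i i]
       - Val u i mu (pit t)).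

End MarkovGame.

Definition Abar (I : finType) (A : I -> finType) : nat := \max_i #|A i|.

(* Main.v *)
Require Import Defs.
From HB Require Import structures.
From mathcomp Require Import ring lra.
From mathcomp Require Import all_boot all_order all_algebra.
From mathcomp Require Import all_classical all_reals all_analysis.
Set Implicit Arguments. Unset Strict Implicit. Unset Printing Implicit Defensive.
Import Order.TTheory GRing.Theory Num.Theory numFieldNormedType.Exports.
Local Open Scope ring_scope.

(* Fix [nu] with d_mu^pi <= 2 kappa nu for every [pi], and follow
   Phi(nu, pi^(t)) along the algorithm.  Replacing the players' policies one at
   a time, each unilateral change moves Phi by the change of the mover's value up
   to alpha; replacing in turn the hybrid opponents by those of pi^(t) costs a
   second-order difference of values, of order
   |I| (eta Abar)^2 / (1 - delta)^5.  By the performance difference lemma and the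
   variational inequality of the projection, what remains is at least
   1/eta times the squared length of the policy move, weighted by occupancy.
   Telescoping bounds the total squared move by eta (C_Phi + ...), whereas the
   Nash gap of pi^(t) is linear in the length of the move, with an occupancy
   weight from [mu] that is compared through [nu]; AM-GM concludes. *)

(** * Finite sums, product measures and projection onto the simplex *)

Section FiniteSums.
Variable R : realType.

(** Distributivity of product over sum. Dependent functions are passed through [fprod], where the
    tagged form of the law applies. *)
Lemma sum_dffun_prod (I : finType) (A : I -> finType)
    (F : forall i, A i -> R) :
  \sum_(a : {dffun forall i, A i}) \prod_i F i (a i) = \prod_i \sum_x F i x.
Proof.
pose G i : {ffun A i -> R} := [ffun x => F i x].
rewrite (reindex (@dffun_of_fprod _ A)); last exact/onW_bij/dffun_of_fprod_bij.
transitivity (\sum_(t : fprod A) \prod_(i in I) G i (t i)).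
  by apply: eq_bigr => t _; apply: eq_bigr => i _; rewrite !ffunE.
rewrite big_fprod -(@bigA_distr_big_dep R 0 1 *%R +%R I _ (tagged_with A)
  (fun i x => untag 0 (G i) x)).
apply: eq_bigr => i _.
have /= <- := @big_tag _ _ _ _ A (fun i x => G i x) i.
by apply: eq_bigr => x _; rewrite ffunE.
Qed.

(* Telescoping: the components of [p] are replaced by those of [s] one at a time. *)
Lemma hybrid_le (I : finType) (B : I -> Type) (F : (forall i, B i) -> R)
    (c : I -> R) (s p : forall i, B i) :
  (forall h i, (forall j, h j = s j \/ h j = p j) -> h i = p i ->
     F (dfwith h i (s i)) - F h <= c i) ->
  F s - F p <= \sum_i c i.
Proof.
move=> step.
pose h (l : seq I) j := if j \in l then s j else p j.
have hyb l : uniq l -> F (h l) - F p <= \sum_(i <- l) c i.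
  elim: l => [_|i l IH /= /andP[il ul]].
    by rewrite big_nil (_ : h [::] = p) ?subrr.
  have hd : h (i :: l) = dfwith (h l) i (s i).
    apply: functional_extensionality_dep => j; rewrite /h inE.
    case: dfwithP => [|k ik]; first by rewrite eqxx.
    by rewrite eq_sym (negbTE ik).
  rewrite big_cons hd.
  have -> : F (dfwith (h l) i (s i)) - F p =
    (F (dfwith (h l) i (s i)) - F (h l)) + (F (h l) - F p) by ring.
  apply: lerD; last exact: IH.
  apply: step => [j|]; rewrite /h; first by case: ifP; [left|right].
  by rewrite (negbTE il).
have := hyb (enum I) (enum_uniq _); rewrite (_ : h (enum I) = s) ?big_enum//.
by apply: functional_extensionality_dep => j; rewrite /h mem_enum.
Qed.

(** Hybrid argument: when one factor changes, the others sum out to their masses. The masses are not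
    assumed to be 1, so that [mpol_dist] can put an arbitrary nonnegative weight in one factor. *)
Lemma l1_prod_le (I : finType) (A : I -> finType) (f g : forall i, A i -> R) :
  (forall i x, 0 <= f i x) -> (forall i x, 0 <= g i x) ->
  (forall i, \sum_x f i x = \sum_x g i x) ->
  \sum_(a : {dffun forall i, A i}) `|\prod_i f i (a i) - \prod_i g i (a i)|
  <= \sum_i (\sum_x `|f i x - g i x|) * \prod_(j | j != i) \sum_x g j x.
Proof.
move=> f0 g0 fg.
pose F (h : forall i, A i -> R) :=
  \sum_(a : {dffun forall i, A i}) `|\prod_i h i (a i) - \prod_i g i (a i)|.
have Fg : F g = 0 by apply: big1 => a _; rewrite subrr normr0.
have := @hybrid_le I (fun i => A i -> R) F
  (fun i => (\sum_x `|f i x - g i x|) * \prod_(j | j != i) \sum_x g j x) f g.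
rewrite Fg subr0; apply => h i hfg hi.
have h0 j x : 0 <= h j x by case: (hfg j) => ->.
(* With [|f i - g i|] in slot [i], the bound is again a sum of products over joint actions and can
   be compared term by term. *)
pose e : forall j, A j -> R := dfwith h i (fun x => `|f i x - g i x|).
have -> : (\sum_x `|f i x - g i x|) * \prod_(j | j != i) \sum_x g j x =
    \sum_(a : {dffun forall i, A i}) \prod_j e j (a j).
  rewrite sum_dffun_prod [RHS](bigD1 i)//= /e dfwithin; congr (_ * _).
  apply: eq_bigr => j ji; rewrite dfwithout 1?eq_sym//.
  by case: (hfg j) => ->.
rewrite /F -sumrB; apply: ler_sum => a _.
apply: (le_trans (lerB_dist _ _)).
rewrite opprB addrA subrK (bigD1 i)//= [X in _ - X](bigD1 i)//= [leRHS](bigD1 i)//=.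
rewrite /e !dfwithin hi.
have E (v : A i -> R) : \prod_(j | j != i) (dfwith h i v : forall j, A j -> R) j (a j)
    = \prod_(j | j != i) h j (a j).
  by apply: eq_bigr => j ji; rewrite dfwithout 1?eq_sym.
by rewrite !E -mulrBl normrM (ger0_norm (prodr_ge0 _ _)).
Qed.

Lemma norm_sum_mul (T : finType) (g h : T -> R) (e M : R) : 0 <= M ->
  \sum_x `|g x| <= e -> (forall x, `|h x| <= M) -> `|\sum_x g x * h x| <= e * M.
Proof.
move=> M0 ge hM; apply: le_trans (ler_norm_sum _ _ _) _.
apply: (@le_trans _ _ ((\sum_x `|g x|) * M)); last exact: ler_wpM2r.
rewrite mulr_suml; apply: ler_sum => x _.
by rewrite normrM ler_wpM2l.
Qed.

(** Cauchy-Schwarz, obtained from the nonnegativity of the variance of [|d x|] about its mean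
    [m]. *)
Lemma sumr_norm_sqr_le (T : finType) (d : T -> R) :
  (\sum_x `|d x|) ^+ 2 <= #|T|%:R * \sum_x d x ^+ 2.
Proof.
case: (posnP #|T|) => [T0|T0].
  have E (F : T -> R) : \sum_x F x = 0.
    by apply: big1 => x _; move: (card0_eq T0 x).
  by rewrite !E mulr0 expr0n.
have T0' : 0 < #|T|%:R :> R by rewrite ltr0n.
set S := \sum_x `|d x|.
set m := S / #|T|%:R.
have : 0 <= \sum_x (`|d x| - m) ^+ 2 by apply: sumr_ge0 => x _; exact: sqr_ge0.
have -> : \sum_x (`|d x| - m) ^+ 2 =
    \sum_x d x ^+ 2 - (2 * m) * S + #|T|%:R * m ^+ 2.
  rewrite /S mulr_sumr -sumrB (mulr_natl (m ^+ 2)) -sumr_const -big_split/=.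
  by apply: eq_bigr => x _; rewrite sqrrB real_normK ?num_real//; ring.
have -> : S = #|T|%:R * m by rewrite /m mulrC divfK ?gt_eqF.
move=> H; rewrite -subr_ge0.
rewrite [leRHS](_ : _ = #|T|%:R *
  (\sum_x d x ^+ 2 - 2 * m * (#|T|%:R * m) + #|T|%:R * m ^+ 2)); last by ring.
exact: mulr_ge0 (ltW T0') H.
Qed.

(* Minimality of [q] tested against [q + l (q' - q)], to first order in [l]. *)
Lemma simplex_proj_le (T : finType) (y q q' : T -> R) :
  is_simplex_proj y q -> is_distr q' ->
  \sum_x (q' x - q x) * (y x - q x) <= 0.
Proof.
move=> [[q0 q1] qmin] [q'0 q'1].
set b := \sum_x _; set D := \sum_x (q' x - q x) ^+ 2.
have D0 : 0 <= D by apply: sumr_ge0 => x _; exact: sqr_ge0.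
have key l : 0 < l -> l <= 1 -> 2 * b <= l * D.
  move=> l0 l1.
  have /qmin : is_distr (fun x => (1 - l) * q x + l * q' x).
    split=> [x|]; first by rewrite addr_ge0// mulr_ge0 ?subr_ge0// ltW.
    by rewrite big_split/= -!mulr_sumr q1 q'1; ring.
  have -> : \sum_x ((1 - l) * q x + l * q' x - y x) ^+ 2 =
      \sum_x (q x - y x) ^+ 2 + (l ^+ 2 * D - (2 * l) * b).
    rewrite /D /b !mulr_sumr -sumrB -big_split/=.
    by apply: eq_bigr => x _; ring.
  rewrite lerDl subr_ge0 => H.
  by rewrite -(ler_pM2l l0); lra.
rewrite leNgt; apply/negP => b0.
have D1 : 0 < 1 + D by lra.
(* If [b] were positive, this [l] would give [l * D <= b], against [2 * b <= l * D]; the 1 in the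
   denominator covers [D = 0]. *)
have := key (Num.min 1 (b / (1 + D))).
have bD : 0 < b / (1 + D) by rewrite divr_gt0.
rewrite lt_min ltr01 bD ge_min lexx => /(_ isT isT).
have : Num.min 1 (b / (1 + D)) * D <= b / (1 + D) * (1 + D).
  apply: ler_pM => //; first by rewrite le_min ler01 ltW.
    by rewrite ge_min lexx orbT.
  by lra.
by rewrite divfK ?gt_eqF//; lra.
Qed.

End FiniteSums.

(** * Discounted occupancy measures *)

Section DiscountedOccupancy.
Variables (R : realType) (I S : finType) (A : I -> finType).
Variables (P : S -> jact A -> S -> R) (delta : R).
Hypothesis P_distr : forall s a, is_distr (P s a).
Hypothesis delta01 : 0 < delta < 1.
Implicit Types (pi : pol R S A) (mu : S -> R) (f : S -> jact A -> R).

Let delta0 : 0 <= delta. Proof. by case/andP: delta01 => /ltW. Qed.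
Let delta1 : 0 < 1 - delta. Proof. by case/andP: delta01 => _; rewrite subr_gt0. Qed.

Lemma jpol_distr pi s : is_pol pi -> is_distr (jpol pi s).
Proof.
move=> ppi; split=> [a|]; first by apply: prodr_ge0 => i _; case: (ppi i s).
rewrite (sum_dffun_prod (fun i => pi i s)) big1// => i _.
by case: (ppi i s).
Qed.

Definition trans pi s s' := \sum_a jpol pi s a * P s a s'.

Lemma trans_distr pi s : is_pol pi -> is_distr (trans pi s).
Proof.
move=> ppi; have [j0 j1] := jpol_distr s ppi; split=> [s'|].
  by apply: sumr_ge0 => a _; rewrite mulr_ge0//; case: (P_distr s a).
rewrite exchange_big/= -[RHS]j1; apply: eq_bigr => a _.
by rewrite -mulr_sumr; case: (P_distr s a) => _ ->; rewrite mulr1.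
Qed.

Lemma stprob_distr mu pi k : is_distr mu -> is_pol pi ->
  is_distr (stprob P mu pi k).
Proof.
move=> dmu ppi; elim: k => [//|k [IH0 IH1]] /=; split=> [s'|].
  by apply: sumr_ge0 => s _; rewrite mulr_ge0//; exact: (trans_distr s ppi).1.
rewrite exchange_big/= -[RHS]IH1; apply: eq_bigr => s _.
by rewrite -mulr_sumr [X in _ * X](trans_distr s ppi).2 mulr1.
Qed.

Lemma dirac_distr (s : S) : is_distr (Defs.dirac R s).
Proof.
split=> [s'|]; first by rewrite /Defs.dirac ler0n.
by rewrite (bigD1 s)//= /Defs.dirac eqxx big1 ?addr0// => s' /negbTE ->.
Qed.

Lemma sum_dirac (s : S) (g : S -> R) : \sum_s' Defs.dirac R s s' * g s' = g s.
Proof.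
rewrite (bigD1 s)//= /Defs.dirac eqxx mul1r big1 ?addr0// => s' /negbTE ->.
by rewrite mul0r.
Qed.

Definition docc_part mu pi s n := \sum_(0 <= k < n) delta ^+ k * stprob P mu pi k s.

(* [occ] without its normalization by [1 - delta]. *)
Definition docc mu pi s := limn (docc_part mu pi s).

Lemma docc_part_ge0 mu pi s n : is_distr mu -> is_pol pi -> 0 <= docc_part mu pi s n.
Proof.
move=> dmu ppi; apply: sumr_ge0 => k _; rewrite mulr_ge0 ?exprn_ge0//.
by case: (stprob_distr k dmu ppi).
Qed.

Lemma docc_part_cvg mu pi s : is_distr mu -> is_pol pi ->
  (docc_part mu pi s @ \oo --> docc mu pi s)%classic.
Proof.
move=> dmu ppi; apply: nondecreasing_is_cvgn.
  apply/nondecreasing_seqP => n; rewrite /docc_part big_nat_recr//= lerDl.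
  by rewrite mulr_ge0 ?exprn_ge0//; case: (stprob_distr n dmu ppi).
exists (1 - delta)^-1 => _ [n _ <-].
apply: (@le_trans _ _ (\sum_(0 <= k < n) delta ^+ k)).
  apply: ler_sum => k _; rewrite ler_piMr ?exprn_ge0//.
  have [st0 <-] := stprob_distr k dmu ppi.
  by rewrite (bigD1 s)//= lerDl sumr_ge0.
rewrite big_mkord -[leRHS]mul1r ler_pdivlMr//.
have := subrX1 delta n => H.
have : 0 <= delta ^+ n by rewrite exprn_ge0.
by move: H; nra.
Qed.

Lemma docc_unique mu pi s l : is_distr mu -> is_pol pi ->
  (docc_part mu pi s @ \oo --> l)%classic -> docc mu pi s = l.
Proof. by move=> dmu ppi H; apply/cvg_lim. Qed.

Lemma cvg_sumr (T : finType) (F : T -> nat -> R) (l : T -> R) :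
  (forall x, F x @ \oo --> l x)%classic ->
  ((fun n => \sum_x F x n) @ \oo --> \sum_x l x)%classic.
Proof. by move=> H; apply: cvg_big => [|x _]; [exact: add_continuous|exact: H]. Qed.

(** Forward equation: time 0 is split off the partial sums, and the last transition of each
    remaining term is exposed before passing to the limit. *)
Lemma docc_flow mu pi s' : is_distr mu -> is_pol pi ->
  docc mu pi s' = mu s' + delta * \sum_s docc mu pi s * trans pi s s'.
Proof.
move=> dmu ppi; apply: docc_unique => //.
rewrite -cvg_shiftS/=.
have -> : (fun n => docc_part mu pi s' n.+1) =
    (fun n => mu s' + delta * \sum_s docc_part mu pi s n * trans pi s s').
  apply/funext => n; rewrite /docc_part big_nat_recl//= expr0 mul1r; congr (_ + _).
  under [in RHS]eq_bigr do rewrite mulr_suml.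
  rewrite exchange_big/= mulr_sumr; apply: eq_bigr => k _.
  by rewrite exprS -mulrA; congr (_ * _); rewrite mulr_sumr; apply: eq_bigr => s _; rewrite mulrA.
apply: cvgD; first exact: cvg_cst.
apply: cvgM; first exact: cvg_cst.
apply: cvg_sumr => s; apply: cvgM; last exact: cvg_cst.
exact: docc_part_cvg.
Qed.

(** [stprob] recurses on the last transition; here the first one is absorbed into the initial
    distribution, as the backward equation [docc_step] requires. *)
Lemma stprob_step mu pi k s' :
  stprob P mu pi k.+1 s' = stprob P (fun s => \sum_t mu t * trans pi t s) pi k s'.
Proof.
elim: k s' => [//|k IH] s'; rewrite [LHS]/= [RHS]/=.
by apply: eq_bigr => s _; rewrite -IH.
Qed.

Lemma stprob_lin mu pi k s' :
  stprob P mu pi k s' = \sum_s mu s * stprob P (Defs.dirac R s) pi k s'.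
Proof.
elim: k s' => [|k IH] s' /=.
  rewrite (bigD1 s')//= /Defs.dirac eqxx mulr1 big1 ?addr0// => s.
  by rewrite eq_sym => /negbTE ->; rewrite mulr0.
under eq_bigr do rewrite IH mulr_suml.
rewrite exchange_big/=; apply: eq_bigr => s _.
by rewrite mulr_sumr; apply: eq_bigr => t _; rewrite mulrA.
Qed.

Lemma docc_lin mu pi s' : is_distr mu -> is_pol pi ->
  docc mu pi s' = \sum_s mu s * docc (Defs.dirac R s) pi s'.
Proof.
move=> dmu ppi; apply: docc_unique => //.
have -> : docc_part mu pi s' =
    (fun n => \sum_s mu s * docc_part (Defs.dirac R s) pi s' n).
  apply/funext => n; rewrite /docc_part.
  under [in RHS]eq_bigr do rewrite mulr_sumr.
  rewrite exchange_big/=; apply: eq_bigr => k _.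
  by rewrite stprob_lin mulr_sumr; apply: eq_bigr => s _; rewrite mulrCA.
apply: cvg_sumr => s; apply: cvgM; first exact: cvg_cst.
exact: docc_part_cvg (dirac_distr s) ppi.
Qed.

(** Backward equation, by conditioning on the first transition; it is the source of [bellman]. *)
Lemma docc_step pi s s' : is_pol pi ->
  docc (Defs.dirac R s) pi s' =
  Defs.dirac R s s' + delta * \sum_t trans pi s t * docc (Defs.dirac R t) pi s'.
Proof.
move=> ppi; have dt := trans_distr s ppi.
rewrite -docc_lin//; apply: docc_unique => //; first exact: dirac_distr.
rewrite -cvg_shiftS/=.
have -> : (fun n => docc_part (Defs.dirac R s) pi s' n.+1) =
    (fun n => Defs.dirac R s s' + delta * docc_part (trans pi s) pi s' n).
  apply/funext => n; rewrite /docc_part big_nat_recl//= expr0 mul1r; congr (_ + _).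
  rewrite mulr_sumr; apply: eq_bigr => k _.
  rewrite -/(stprob P (Defs.dirac R s) pi k.+1 s') stprob_step exprS -mulrA.
  congr (_ * (_ * stprob _ _ _ _ _)).
  by apply/funext => t; rewrite sum_dirac.
apply: cvgD; first exact: cvg_cst.
by apply: cvgM; [exact: cvg_cst|exact: docc_part_cvg].
Qed.

Lemma docc_ge0 mu pi s : is_distr mu -> is_pol pi -> 0 <= docc mu pi s.
Proof.
move=> dmu ppi; apply: limr_ge.
  by apply/cvg_ex; exists (docc mu pi s); exact: docc_part_cvg.
by apply: nearW => n; exact: docc_part_ge0.
Qed.

(** The time-0 term alone gives the bound. It holds for every policy, which is what permits the
    change of measure in [regret_step]. *)
Lemma docc_ge mu pi s : is_distr mu -> is_pol pi -> mu s <= docc mu pi s.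
Proof.
move=> dmu ppi; rewrite docc_flow// lerDl mulr_ge0//.
apply: sumr_ge0 => t _; rewrite mulr_ge0 ?docc_ge0//.
by case: (trans_distr t ppi).
Qed.

(** [docc_flow] integrated against [g]. The choice [g = 1] gives the total mass, and [g] a value
    function gives the performance difference lemma. *)
Lemma docc_test mu pi (g : S -> R) : is_distr mu -> is_pol pi ->
  \sum_s docc mu pi s * (g s - delta * \sum_s' trans pi s s' * g s') =
  \sum_s mu s * g s.
Proof.
move=> dmu ppi.
have E : \sum_s docc mu pi s * g s = \sum_s mu s * g s +
    \sum_s docc mu pi s * (delta * \sum_s' trans pi s s' * g s').
  under eq_bigr do rewrite docc_flow// mulrDl.
  rewrite big_split/=; congr (_ + _).
  under eq_bigr do rewrite -mulrA mulr_suml mulr_sumr.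
  rewrite exchange_big/=; apply: eq_bigr => s _.
  rewrite !mulr_sumr; apply: eq_bigr => s' _; ring.
by under eq_bigr do rewrite mulrBr; rewrite sumrB E; ring.
Qed.

Lemma docc_sum mu pi : is_distr mu -> is_pol pi ->
  \sum_s docc mu pi s = (1 - delta)^-1.
Proof.
move=> dmu ppi; have := docc_test (fun=> 1) dmu ppi.
under [X in _ = X -> _]eq_bigr do rewrite mulr1.
case: (dmu) => _ ->.
under eq_bigr => s _ do [under eq_bigr do rewrite mulr1;
  rewrite (trans_distr s ppi).2 mulr1].
rewrite -mulr_suml => /(canRL (mulfK _)) ->; first by rewrite mul1r.
by rewrite gt_eqF.
Qed.

End DiscountedOccupancy.

(** * Values, the Bellman equation and the performance difference lemma *)

Section Value.
Variables (R : realType) (I S : finType) (A : I -> finType).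
Variables (P : S -> jact A -> S -> R) (delta : R).
Hypothesis P_distr : forall s a, is_distr (P s a).
Hypothesis delta01 : 0 < delta < 1.
Implicit Types (pi : pol R S A) (mu : S -> R) (f : S -> jact A -> R).

Let delta0 : 0 <= delta. Proof. by case/andP: delta01 => /ltW. Qed.
Let delta1 : 0 < 1 - delta. Proof. by case/andP: delta01 => _; rewrite subr_gt0. Qed.

(** The reward [f] is not tied to a player's payoff: [second_difference] also uses an advantage
    function as a reward. *)
Definition dval f mu pi :=
  \sum_s docc P delta mu pi s * \sum_a jpol pi s a * f s a.

Definition jQ f pi s a :=
  f s a + delta * \sum_s' P s a s' * dval f (Defs.dirac R s') pi.

Lemma Val_dval (u : I -> S -> jact A -> R) i mu pi :
  is_distr mu -> is_pol pi -> Val P delta u i mu pi = dval (u i) mu pi.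
Proof.
move=> dmu ppi; rewrite /Val; apply/cvg_lim => //.
rewrite (_ : (fun n => _) = (fun n => \sum_s docc_part P delta mu pi s n *
    \sum_a jpol pi s a * u i s a)).
  apply: cvg_sumr => s; apply: cvgM; last exact: cvg_cst.
  exact: docc_part_cvg.
apply/funext => n; under [RHS]eq_bigr do rewrite mulr_suml.
rewrite exchange_big/=; apply: eq_bigr => k _.
by rewrite mulr_sumr; apply: eq_bigr => s _; rewrite mulrA.
Qed.

Lemma dval_lin f mu pi : is_distr mu -> is_pol pi ->
  dval f mu pi = \sum_s mu s * dval f (Defs.dirac R s) pi.
Proof.
move=> dmu ppi; rewrite /dval.
under eq_bigr do rewrite docc_lin// mulr_suml.
rewrite exchange_big/=; apply: eq_bigr => s _.
by rewrite mulr_sumr; apply: eq_bigr => t _; rewrite mulrA.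
Qed.

Lemma dval_bound f (M : R) mu pi : is_distr mu -> is_pol pi ->
  (forall s a, `|f s a| <= M) -> `|dval f mu pi| <= M / (1 - delta).
Proof.
move=> dmu ppi fM; rewrite -(docc_sum P_distr delta01 dmu ppi) mulr_sumr.
apply: le_trans (ler_norm_sum _ _ _) _; apply: ler_sum => s _.
have D0 := docc_ge0 P_distr delta01 s dmu ppi.
rewrite normrM ger0_norm// mulrC ler_wpM2r//.
have [j0 j1] := jpol_distr s ppi.
rewrite -[M]mulr1 -j1 mulr_sumr.
apply: le_trans (ler_norm_sum _ _ _) _; apply: ler_sum => a _.
by rewrite normrM ger0_norm// mulrC ler_wpM2r.
Qed.

Lemma dval_ge0 f mu pi : is_distr mu -> is_pol pi ->
  (forall s a, 0 <= f s a) -> 0 <= dval f mu pi.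
Proof.
move=> dmu ppi f0; apply: sumr_ge0 => s _.
rewrite mulr_ge0 ?docc_ge0//; apply: sumr_ge0 => a _.
by rewrite mulr_ge0//; case: (jpol_distr s ppi).
Qed.

Lemma jQ_bound f (M : R) pi s a : is_pol pi ->
  (forall s a, `|f s a| <= M) -> `|jQ f pi s a| <= M / (1 - delta).
Proof.
move=> ppi fM; have [P0 P1] := P_distr s a.
(* [M / (1 - delta)] is the fixed point of [x = M + delta * x], so the bound splits along the two
   terms of [jQ]. *)
have -> : M / (1 - delta) = M + delta * \sum_s' P s a s' * (M / (1 - delta)).
  by rewrite -mulr_suml P1; field; rewrite gt_eqF.
apply: le_trans (ler_normD _ _) _; apply: lerD => //.
rewrite normrM ger0_norm// ler_wpM2l//.
apply: le_trans (ler_norm_sum _ _ _) _; apply: ler_sum => s' _.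
rewrite normrM ger0_norm// ler_wpM2l// dval_bound//; exact: dirac_distr.
Qed.

Lemma sum_jpol_jQ f pi pi' s :
  \sum_a jpol pi' s a * jQ f pi s a = \sum_a jpol pi' s a * f s a +
    delta * \sum_s' trans P pi' s s' * dval f (Defs.dirac R s') pi.
Proof.
under eq_bigr do rewrite mulrDr.
rewrite big_split/=; congr (_ + _).
under [in RHS]eq_bigr do rewrite mulr_suml.
rewrite exchange_big/= mulr_sumr; apply: eq_bigr => a _.
by rewrite mulrCA mulr_sumr; congr (_ * _); apply: eq_bigr => s' _; rewrite mulrA.
Qed.

Lemma bellman f pi s : is_pol pi ->
  dval f (Defs.dirac R s) pi = \sum_a jpol pi s a * jQ f pi s a.
Proof.
move=> ppi; rewrite sum_jpol_jQ {1}/dval.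
under eq_bigr do rewrite docc_step// mulrDl.
rewrite big_split/= sum_dirac; congr (_ + _).
under eq_bigr do rewrite -mulrA mulr_suml.
rewrite -mulr_sumr exchange_big/=; congr (_ * _); apply: eq_bigr => t _.
by rewrite mulr_sumr; apply: eq_bigr => s' _; rewrite mulrA.
Qed.

(** [docc_test] for [pi'], with [g] the value of [pi], writes the value of [pi] as an
    occupancy-weighted sum of Bellman residuals. Hence the occupancy is that of [pi'] and the
    continuation values are those of [pi]. *)
Lemma performance_difference f mu pi pi' : is_distr mu -> is_pol pi -> is_pol pi' ->
  dval f mu pi' - dval f mu pi = \sum_s docc P delta mu pi' s *
    \sum_a (jpol pi' s a - jpol pi s a) * jQ f pi s a.
Proof.
move=> dmu ppi ppi'.
rewrite (dval_lin f dmu ppi) -(docc_test P_distr delta01 _ dmu ppi') -sumrB.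
apply: eq_bigr => s _; rewrite -mulrBr; congr (_ * _).
under [RHS]eq_bigr do rewrite mulrBl.
by rewrite sumrB -bellman// sum_jpol_jQ; ring.
Qed.

Lemma docc_norm_sum (g : S -> R) (M : R) mu pi : is_distr mu -> is_pol pi ->
  (forall s, `|g s| <= M) ->
  `|\sum_s docc P delta mu pi s * g s| <= M / (1 - delta).
Proof.
move=> dmu ppi gM; rewrite -(docc_sum P_distr delta01 dmu ppi) mulr_sumr.
apply: le_trans (ler_norm_sum _ _ _) _; apply: ler_sum => s _.
have D0 := docc_ge0 P_distr delta01 s dmu ppi.
by rewrite normrM ger0_norm// mulrC ler_wpM2r.
Qed.

(** One factor [1 / (1 - delta)] comes from the size of [jQ], the other from the mass of the
    occupancy measure. *)
Lemma dval_dist f (M e : R) mu pi pi' : is_distr mu -> is_pol pi -> is_pol pi' ->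
  0 <= M -> (forall s a, `|f s a| <= M) ->
  (forall s, \sum_a `|jpol pi' s a - jpol pi s a| <= e) ->
  `|dval f mu pi' - dval f mu pi| <= e * M / (1 - delta) ^+ 2.
Proof.
move=> dmu ppi ppi' M0 fM ee; rewrite performance_difference//.
have -> : e * M / (1 - delta) ^+ 2 = (e * (M / (1 - delta))) / (1 - delta).
  by field; rewrite gt_eqF.
apply: docc_norm_sum => // s; apply: norm_sum_mul => // [|a].
  by rewrite divr_ge0// ltW.
exact: jQ_bound.
Qed.

End Value.

(** * Unilateral deviations and second-order differences *)

Section Deviations.
Variables (R : realType) (I S : finType) (A : I -> finType).
Variables (P : S -> jact A -> S -> R) (delta : R).
Hypothesis P_distr : forall s a, is_distr (P s a).
Hypothesis delta01 : 0 < delta < 1.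
Implicit Types (pi : pol R S A) (mu : S -> R) (f : S -> jact A -> R).

Let delta1 : 0 < 1 - delta. Proof. by case/andP: delta01 => _; rewrite subr_gt0. Qed.

Lemma dev_in pi i (p : S -> A i -> R) : (dev pi p) i = p.
Proof. by rewrite /dev dfwithin. Qed.

Lemma dev_out pi i (p : S -> A i -> R) j : j != i -> (dev pi p) j = pi j.
Proof. by move=> ji; rewrite /dev dfwithout// eq_sym. Qed.

Lemma is_pol_dev pi i (p : S -> A i -> R) :
  is_pol pi -> is_pol_i p -> is_pol (dev pi p).
Proof.
move=> ppi pp j; have [->|ji] := eqVneq j i; first by rewrite dev_in.
by rewrite dev_out.
Qed.

Lemma jpol_dev pi i (p : S -> A i -> R) s a :
  jpol (dev pi p) s a = p s (a i) * mpol pi i s a.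
Proof.
rewrite /jpol (bigD1 i)//= dev_in; congr (_ * _).
by apply: eq_bigr => j ji; rewrite dev_out.
Qed.

Lemma jpolE pi i s a : jpol pi s a = pi i s (a i) * mpol pi i s a.
Proof. by rewrite /jpol (bigD1 i). Qed.

Lemma mpol_ge0 pi i s a : is_pol pi -> 0 <= mpol pi i s a.
Proof. by move=> ppi; apply: prodr_ge0 => j _; case: (ppi j s). Qed.

Lemma sum_mpol i (w : A i -> R) pi s : is_pol pi ->
  \sum_(a : jact A) w (a i) * mpol pi i s a = \sum_x w x.
Proof.
move=> ppi; under eq_bigr do rewrite -(jpol_dev pi (fun=> w)) /jpol.
rewrite (sum_dffun_prod (fun j => (dev pi (fun=> w)) j s)) (bigD1 i)//= dev_in.
rewrite [X in _ * X]big1 ?mulr1// => j ji; rewrite dev_out//.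
by case: (ppi j s).
Qed.

Lemma jpol_dist pi pi' s : is_pol pi -> is_pol pi' ->
  \sum_a `|jpol pi' s a - jpol pi s a| <= \sum_i \sum_x `|pi' i s x - pi i s x|.
Proof.
move=> ppi ppi'.
apply: le_trans (@l1_prod_le R I A (fun i => pi' i s) (fun i => pi i s) _ _ _) _
  => [i x|i x|i|].
- by case: (ppi' i s).
- by case: (ppi i s).
- by rewrite (ppi i s).2 (ppi' i s).2.
apply: ler_sum => i _; rewrite [X in _ * X]big1 ?mulr1// => j _.
by case: (ppi j s).
Qed.

Lemma mpol_dist i (w : A i -> R) pi pi' s : (forall x, 0 <= w x) ->
  is_pol pi -> is_pol pi' -> pi' i = pi i ->
  \sum_(a : jact A) `|w (a i) * mpol pi' i s a - w (a i) * mpol pi i s a|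
  <= (\sum_x w x) * \sum_j \sum_x `|pi' j s x - pi j s x|.
Proof.
move=> w0 ppi ppi' pii; pose W p : pol R S A := dev p (fun=> w).
have W0 p : is_pol p -> forall j x, 0 <= W p j s x.
  move=> pp j; have [->|ji] := eqVneq j i; first by rewrite /W dev_in.
  by rewrite /W dev_out//; exact: (pp j s).1.
under eq_bigr do rewrite -!(jpol_dev _ (fun=> w)).
apply: le_trans (@l1_prod_le R I A (fun j => W pi' j s) (fun j => W pi j s)
  (W0 _ ppi') (W0 _ ppi) _) _ => [j|].
  have [->|ji] := eqVneq j i; first by rewrite /W !dev_in.
  by rewrite /W !dev_out// (ppi j s).2 (ppi' j s).2.
rewrite mulr_sumr; apply: ler_sum => j _.
have [->|ji] := eqVneq j i.
  rewrite /W !dev_in big1 ?mul0r; last by move=> x _; rewrite subrr normr0.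
  by rewrite mulr_ge0// sumr_ge0.
rewrite /W !dev_out// mulrC ler_wpM2r ?sumr_ge0//.
rewrite (bigD1 i) 1?eq_sym//= dev_in [X in _ * X]big1 ?mulr1// => k /andP[_ ki].
by rewrite dev_out//; exact: (ppi k s).2.
Qed.

Lemma dval_dev f mu pi i (p : S -> A i -> R) : is_distr mu -> is_pol pi -> is_pol_i p ->
  dval P delta f mu (dev pi p) - dval P delta f mu pi =
  \sum_s docc P delta mu (dev pi p) s *
    \sum_(a : jact A) (p s (a i) - pi i s (a i)) * mpol pi i s a * jQ P delta f pi s a.
Proof.
move=> dmu ppi pp; rewrite performance_difference//; last exact: is_pol_dev.
apply: eq_bigr => s _; congr (_ * _); apply: eq_bigr => a _.
by rewrite jpol_dev (jpolE _ i) -mulrBl.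
Qed.

(* The advantage of a deviation depends on the opponents' policies only through
   the occupancy measure, the opponents' action probabilities and the
   continuation values, each of which is Lipschitz in the opponents' policies. *)
Lemma second_difference f mu pi pi' i (p : S -> A i -> R) (eps e : R) :
  is_distr mu -> is_pol pi -> is_pol pi' -> is_pol_i p -> pi' i = pi i ->
  0 <= eps -> 0 <= e ->
  (forall s a, `|f s a| <= 1) ->
  (forall s, \sum_x `|p s x - pi i s x| <= eps) ->
  (forall s, \sum_j \sum_x `|pi' j s x - pi j s x| <= e) ->
  `| (dval P delta f mu (dev pi' p) - dval P delta f mu pi')
     - (dval P delta f mu (dev pi p) - dval P delta f mu pi) |
  <= 2 * eps * e / (1 - delta) ^+ 3.
Proof.
move=> dmu ppi ppi' pp pii eps0 e0 f1 heps he.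
have dpi := is_pol_dev ppi pp; have dpi' := is_pol_dev ppi' pp.
have jl s : \sum_a `|jpol pi' s a - jpol pi s a| <= e.
  exact: le_trans (jpol_dist _ _ _) (he s).
have jl' s : \sum_a `|jpol (dev pi' p) s a - jpol (dev pi p) s a| <= e.
  apply: le_trans (jpol_dist _ _ _) _ => //.
  apply: le_trans (he s); apply: ler_sum => j _.
  have [->|ji] := eqVneq j i; last by rewrite !dev_out.
  rewrite !dev_in big1 ?sumr_ge0// => x _.
  by rewrite subrr normr0.
pose D q s (a : jact A) := (p s (a i) - pi i s (a i)) * mpol q i s a.
pose B q s := \sum_a D q s a * jQ P delta f q s a.
have M0 : 0 <= (1 - delta)^-1 by rewrite invr_ge0 ltW.
have D1 q s : is_pol q -> \sum_a `|D q s a| <= eps.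
  move=> pq; apply: le_trans (heps s).
  rewrite -(sum_mpol (fun x => `|p s x - pi i s x|) s pq).
  by apply: ler_sum => a _; rewrite normrM (ger0_norm (mpol_ge0 _ _ _ pq)).
have B1 q s : is_pol q -> `|B q s| <= eps / (1 - delta).
  move=> pq; apply: norm_sum_mul => // [|a]; first exact: D1.
  by rewrite -[leRHS]mul1r; exact: jQ_bound.
(* Product rule: first the opponents' action probabilities change, then the continuation values. The
   two bounds add up exactly since [(1 - delta) + delta = 1]. *)
have dB s : `|B pi' s - B pi s| <= eps * e / (1 - delta) ^+ 2.
  have -> : B pi' s - B pi s = \sum_a (D pi' s a - D pi s a) * jQ P delta f pi' s a
     + \sum_a D pi s a * (jQ P delta f pi' s a - jQ P delta f pi s a).
    by rewrite -sumrB -big_split/=; apply: eq_bigr => a _; ring.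
  apply: le_trans (ler_normD _ _) _.
  have -> : eps * e / (1 - delta) ^+ 2 =
    (eps * e) * (1 - delta)^-1 + eps * (delta * (e / (1 - delta) ^+ 2)).
    by field; rewrite gt_eqF.
  apply: lerD.
    apply: norm_sum_mul => // [|a]; last by rewrite -[leRHS]mul1r; exact: jQ_bound.
    have := @mpol_dist i (fun x => `|p s x - pi i s x|) pi pi' s.
    move=> /(_ (fun=> normr_ge0 _) ppi ppi' pii) => H.
    apply: (@le_trans _ _ ((\sum_x `|p s x - pi i s x|) *
        \sum_j \sum_x `|pi' j s x - pi j s x|)); last first.
      by apply: ler_pM => //; rewrite ?sumr_ge0// => j _; rewrite sumr_ge0.
    apply: le_trans H; apply: ler_sum => a _.
    by rewrite /D -!mulrBr !normrM normr_id.
  have de : 0 <= e / (1 - delta) ^+ 2 by rewrite divr_ge0// exprn_ge0// ltW.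
  have d0 : 0 <= delta by case/andP: delta01 => /ltW.
  apply: norm_sum_mul => // [||a]; [exact: mulr_ge0|exact: D1|].
  rewrite /jQ opprD addrACA subrr add0r -mulrBr normrM ger0_norm// ler_wpM2l//.
  rewrite -sumrB; under eq_bigr do rewrite -mulrBr.
  have [P0 P1] := P_distr s a.
  rewrite -[leRHS]mul1r; apply: norm_sum_mul => // [|s'].
    by rewrite -P1; apply: ler_sum => s' _; rewrite ger0_norm.
  rewrite -[e]mulr1; apply: dval_dist => //; exact: dirac_distr.
have E q : is_pol q -> q i = pi i ->
    dval P delta f mu (dev q p) - dval P delta f mu q =
    \sum_s docc P delta mu (dev q p) s * B q s.
  move=> pq qi; rewrite dval_dev//; apply: eq_bigr => s _.
  by rewrite qi.
rewrite !E//.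
(* The advantage [B pi], read as a reward independent of the action, turns a change of occupancy
   into a difference of values, controlled by [dval_dist]. *)
have Eb q : is_pol q -> \sum_s docc P delta mu q s * B pi s =
    dval P delta (fun s _ => B pi s) mu q.
  move=> pq; apply: eq_bigr => s _; rewrite -mulr_suml.
  by case: (jpol_distr s pq) => _ ->; rewrite mul1r.
have -> : \sum_s docc P delta mu (dev pi' p) s * B pi' s -
    \sum_s docc P delta mu (dev pi p) s * B pi s =
  \sum_s docc P delta mu (dev pi' p) s * (B pi' s - B pi s) +
  (dval P delta (fun s _ => B pi s) mu (dev pi' p) -
   dval P delta (fun s _ => B pi s) mu (dev pi p)).
  by rewrite -!Eb// -!sumrB -big_split/=; apply: eq_bigr => s _; ring.
apply: le_trans (ler_normD _ _) _.
have -> : 2 * eps * e / (1 - delta) ^+ 3 = eps * e / (1 - delta) ^+ 2 / (1 - delta)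
   + e * (eps / (1 - delta)) / (1 - delta) ^+ 2.
  by field; rewrite gt_eqF.
apply: lerD; first exact: docc_norm_sum.
by apply: dval_dist => // [|s _]; [exact: mulr_ge0|exact: B1].
Qed.

End Deviations.

(** * Values and Q-functions of a single player *)

Section PlayerValue.
Variables (R : realType) (I S : finType) (A : I -> finType).
Variables (P : S -> jact A -> S -> R) (delta : R) (u : I -> S -> jact A -> R).
Hypothesis P_distr : forall s a, is_distr (P s a).
Hypothesis delta01 : 0 < delta < 1.
Hypothesis u01 : forall i s a, 0 <= u i s a <= 1.

Let delta1 : 0 < 1 - delta. Proof. by case/andP: delta01 => _; rewrite subr_gt0. Qed.
Let u1 i s a : `|u i s a| <= 1.
Proof. by case/andP: (u01 i s a) => u0 ?; rewrite ger0_norm. Qed.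

Lemma QfE i (pi : pol R S A) s (x : A i) : is_pol pi ->
  Qf P delta u pi s x =
  \sum_(a : jact A | a i == x) mpol pi i s a * jQ P delta (u i) pi s a.
Proof.
move=> ppi; apply: eq_bigr => a _; congr (_ * (_ + _ * _)).
by apply: eq_bigr => s' _; rewrite Val_dval//; exact: dirac_distr.
Qed.

Lemma Qf_bound i (pi : pol R S A) s (x : A i) : is_pol pi ->
  `|Qf P delta u pi s x| <= (1 - delta)^-1.
Proof.
move=> ppi; rewrite QfE//.
(* Over joint actions with [a i = x] the opponents' weights sum to 1, so [Qf] is an average of
   [jQ]. *)
have -> : (1 - delta)^-1 = \sum_(a : jact A | a i == x) mpol pi i s a * (1 - delta)^-1.
  rewrite -mulr_suml [X in X * _](_ : _ = 1) ?mul1r//.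
  transitivity (\sum_(y : A i) (y == x)%:R : R).
    rewrite -(sum_mpol (fun y => (y == x)%:R) s ppi) big_mkcond/=.
    by apply: eq_bigr => a _; case: eqP; rewrite ?mul1r ?mul0r.
  by rewrite (bigD1 x)//= eqxx big1 ?addr0// => y /negbTE ->.
apply: le_trans (ler_norm_sum _ _ _) _; apply: ler_sum => a _.
have m0 := mpol_ge0 i s a ppi.
rewrite normrM ger0_norm// ler_wpM2l//.
by rewrite -[leRHS]mul1r; exact: jQ_bound.
Qed.

(** Joint actions are grouped by the deviator's action, which turns [jQ] into [Qf], the direction of
    the gradient step. *)
Lemma Val_dev i mu (pi : pol R S A) (p : S -> A i -> R) :
  is_distr mu -> is_pol pi -> is_pol_i p ->
  Val P delta u i mu (dev pi p) - Val P delta u i mu pi =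
  \sum_s docc P delta mu (dev pi p) s *
    \sum_x (p s x - pi i s x) * Qf P delta u pi s x.
Proof.
move=> dmu ppi pp; rewrite !Val_dval//; last exact: is_pol_dev.
rewrite dval_dev//; apply: eq_bigr => s _; congr (_ * _).
rewrite (partition_big (fun a : jact A => a i) predT)//=.
apply: eq_bigr => x _; rewrite QfE// mulr_sumr; apply: eq_bigr => a /eqP <-.
by rewrite mulrA.
Qed.

Lemma Val_itv i mu (pi : pol R S A) : is_distr mu -> is_pol pi ->
  0 <= Val P delta u i mu pi <= (1 - delta)^-1.
Proof.
move=> dmu ppi; rewrite Val_dval//; apply/andP; split.
  by apply: dval_ge0 => // s a; case/andP: (u01 i s a).
apply: le_trans (ler_norm _) _; rewrite -[leRHS]mul1r; exact: dval_bound.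
Qed.

Lemma Val_lin i mu (pi : pol R S A) : is_distr mu -> is_pol pi ->
  Val P delta u i mu pi = \sum_s mu s * Val P delta u i (Defs.dirac R s) pi.
Proof.
move=> dmu ppi; rewrite Val_dval// dval_lin//; apply: eq_bigr => s _.
by rewrite Val_dval//; exact: dirac_distr.
Qed.

End PlayerValue.

(** * One projected gradient step on a simplex *)

Section ProjectedStep.
Variables (R : realType) (T : finType).
Implicit Types p q Q : T -> R.

(** Variational inequality of the projection, tested at the starting point [p]. *)
Lemma proj_step_sqr_le p q Q (eta : R) : is_distr p ->
  is_simplex_proj (fun x => p x + eta * Q x) q ->
  \sum_x (q x - p x) ^+ 2 <= eta * \sum_x (q x - p x) * Q x.
Proof.
move=> dp hq; rewrite -subr_le0 mulr_sumr -sumrB.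
rewrite [leLHS](_ : _ = \sum_x (p x - q x) * (p x + eta * Q x - q x)).
  exact: simplex_proj_le.
by apply: eq_bigr => x _; ring.
Qed.

(** Cauchy-Schwarz and [proj_step_sqr_le] bound the square of the l1 length by a multiple of that
    length; one factor is then cancelled. *)
Lemma proj_step_l1_le p q Q (eta M : R) : 0 <= eta -> is_distr p ->
  is_simplex_proj (fun x => p x + eta * Q x) q ->
  0 <= M -> (forall x, `|Q x| <= M) ->
  \sum_x `|q x - p x| <= eta * #|T|%:R * M.
Proof.
move=> eta0 dp hq M0 QM; set n1 := \sum_x _.
have n10 : 0 <= n1 by exact: sumr_ge0.
have H : n1 ^+ 2 <= #|T|%:R * (eta * (n1 * M)).
  apply: le_trans (sumr_norm_sqr_le _) _; rewrite ler_wpM2l//.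
  apply: le_trans (proj_step_sqr_le dp hq) _; rewrite ler_wpM2l//.
  apply: le_trans (ler_norm _) _; exact: norm_sum_mul.
have [n1p|] := ltP 0 n1; first by rewrite -(ler_pM2l n1p); move: H; lra.
by move=> n1n; apply: le_trans n1n _; rewrite !mulr_ge0.
Qed.

Lemma distr_sqr_sum_le1 p : is_distr p -> \sum_x p x ^+ 2 <= 1.
Proof.
move=> [p0 p1]; rewrite -[leRHS]p1; apply: ler_sum => x _.
rewrite expr2 ler_piMr// -p1 (bigD1 x)//= lerDl; exact: sumr_ge0.
Qed.

(* [lambda] is the free parameter of AM-GM, applied to |p' - q| |q - p| and to
   eta M |q - p|_1. *)
Lemma proj_step_gap p q p' Q (eta M lambda : R) : 0 <= eta -> is_distr p ->
  is_simplex_proj (fun x => p x + eta * Q x) q -> is_distr p' ->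
  0 <= M -> (forall x, `|Q x| <= M) -> eta * #|T|%:R * M <= 1 -> 0 < lambda ->
  eta * \sum_x (p' x - p x) * Q x
  <= 3 / 2 * (lambda + (\sum_x (q x - p x) ^+ 2) / lambda).
Proof.
move=> eta0 dp hq dp' M0 QM small l0; have [dq _] := hq.
set D := \sum_x (q x - p x) ^+ 2.
have D0 : 0 <= D by apply: sumr_ge0 => x _; exact: sqr_ge0.
have amgm (a b : R) : a * b <= lambda / 2 * a ^+ 2 + b ^+ 2 / (2 * lambda).
  rewrite -subr_ge0 (_ : _ - _ = (lambda * a - b) ^+ 2 / (2 * lambda)).
    by rewrite divr_ge0 ?sqr_ge0// mulr_ge0// ltW.
  by field; rewrite gt_eqF.
have V : eta * \sum_x (p' x - q x) * Q x <= \sum_x (p' x - q x) * (q x - p x).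
  rewrite -subr_le0 mulr_sumr -sumrB.
  rewrite [leLHS](_ : _ = \sum_x (p' x - q x) * (p x + eta * Q x - q x)).
    exact: simplex_proj_le.
  by apply: eq_bigr => x _; ring.
(* The cross terms [p' x * q x] are nonnegative and each squared norm is at most 1, so the squared
   distance from [p'] to [q] is at most 2. *)
have V1 : \sum_x (p' x - q x) * (q x - p x) <= lambda + D / (2 * lambda).
  apply: (@le_trans _ _ (\sum_x (lambda / 2 * (p' x ^+ 2 + q x ^+ 2)
      + (q x - p x) ^+ 2 / (2 * lambda)))).
    apply: ler_sum => x _; apply: le_trans (amgm _ _) _.
    rewrite lerD2r; apply: ler_wpM2l; first by rewrite divr_ge0// ltW.
    have := mulr_ge0 (dp'.1 x) (dq.1 x); nra.
  rewrite big_split/= -mulr_sumr -mulr_suml lerD2r big_split/=.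
  have := distr_sqr_sum_le1 dp'; have := distr_sqr_sum_le1 dq; nra.
(* AM-GM with first factor 1; the smallness of [eta] absorbs the cardinality coming from
   Cauchy-Schwarz. *)
have V2 : eta * \sum_x (q x - p x) * Q x <= lambda / 2 + D / (2 * lambda).
  set n1 := \sum_x `|q x - p x|.
  have n10 : 0 <= n1 by exact: sumr_ge0.
  apply: (@le_trans _ _ (1 * (eta * (n1 * M)))).
    rewrite mul1r ler_wpM2l//; apply: le_trans (ler_norm _) _; exact: norm_sum_mul.
  apply: le_trans (amgm _ _) _; rewrite expr1n mulr1 lerD2l.
  apply: ler_wpM2r; first by rewrite invr_ge0 mulr_ge0// ltW.
  have H := sumr_norm_sqr_le (fun x => q x - p x); rewrite -/n1 -/D in H.
  have [T0|T1] := posnP #|T|.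
    have -> : n1 = 0 by apply: big1 => x _; move: (card0_eq T0 x).
    by rewrite mul0r mulr0 expr0n.
  have T1' : 1 <= #|T|%:R :> R by rewrite ler1n.
  rewrite (_ : (eta * (n1 * M)) ^+ 2 = (eta * M) ^+ 2 * n1 ^+ 2); last by ring.
  apply: le_trans (ler_wpM2l (sqr_ge0 _) H) _; rewrite mulrA ler_piMl//.
  have e0 : 0 <= eta * M by rewrite mulr_ge0.
  apply: (@le_trans _ _ ((eta * #|T|%:R * M) ^+ 2)); last first.
    by rewrite expr_le1// !mulr_ge0.
  rewrite (_ : (eta * #|T|%:R * M) ^+ 2 = (eta * M) ^+ 2 * #|T|%:R ^+ 2); last by ring.
  by rewrite ler_wpM2l ?sqr_ge0// expr2 ler_peMl.
have -> : \sum_x (p' x - p x) * Q x =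
    \sum_x (p' x - q x) * Q x + \sum_x (q x - p x) * Q x.
  by rewrite -big_split/=; apply: eq_bigr => x _; ring.
have -> : 3 / 2 * (lambda + D / lambda) =
    (lambda + D / (2 * lambda)) + (lambda / 2 + D / (2 * lambda)) + D / lambda / 2.
  by field; rewrite gt_eqF.
have : 0 <= D / lambda by rewrite divr_ge0// ltW.
lra.
Qed.

End ProjectedStep.

(** * One simultaneous step of all players *)

Section PolicyStep.
Variables (R : realType) (I S : finType) (A : I -> finType).
Variables (P : S -> jact A -> S -> R) (delta : R) (u : I -> S -> jact A -> R).
Variables (alpha : R) (Phi : S -> pol R S A -> R) (eta : R) (pi pi' : pol R S A).
Arguments pi : clear implicits.
Arguments pi' : clear implicits.
Hypothesis P_distr : forall s a, is_distr (P s a).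
Hypothesis delta01 : 0 < delta < 1.
Hypothesis u01 : forall i s a, 0 <= u i s a <= 1.
Hypothesis eta_gt0 : 0 < eta.
Hypothesis ppi : is_pol pi.
Hypothesis step : forall i s, is_simplex_proj
  (fun x => pi i s x + eta * Qf P delta u pi s x) (pi' i s).

Let delta1 : 0 < 1 - delta. Proof. by case/andP: delta01 => _; rewrite subr_gt0. Qed.
Let M0 : 0 <= (1 - delta)^-1. Proof. by rewrite invr_ge0 ltW. Qed.
Let ppi' : is_pol pi'. Proof. by move=> i s; case: (step i s). Qed.
Let eta0 : 0 <= eta. Proof. exact: ltW. Qed.

Definition sqr_move i s := \sum_x (pi' i s x - pi i s x) ^+ 2.

(** Each move is weighted by the occupancy of the policy in which that player alone has moved, the
    weight that the performance difference lemma produces. *)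
Definition total_move nu :=
  \sum_i \sum_s docc P delta nu (dev pi (pi' i)) s * sqr_move i s.

Let sqr_move_ge0 i s : 0 <= sqr_move i s.
Proof. by apply: sumr_ge0 => x _; exact: sqr_ge0. Qed.

Lemma card_le_Abar i : #|A i|%:R <= (Abar A)%:R :> R.
Proof. by rewrite ler_nat; exact: (@leq_bigmax _ (fun i => #|A i|) i). Qed.

Lemma policy_l1_move i s :
  \sum_x `|pi' i s x - pi i s x| <= eta * (Abar A)%:R / (1 - delta).
Proof.
apply: le_trans (proj_step_l1_le eta0 (ppi i s) (step i s) M0 _) _.
  by move=> x; exact: Qf_bound.
by rewrite ler_wpM2r// ler_wpM2l// card_le_Abar.
Qed.

Lemma Phimu_dev nu h i (p : S -> A i -> R) :
  is_alpha_potential P delta u alpha Phi ->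
  is_distr nu -> is_pol h -> is_pol_i p ->
  Val P delta u i nu (dev h p) - Val P delta u i nu h - alpha
  <= Phimu Phi nu (dev h p) - Phimu Phi nu h.
Proof.
move=> pot dnu ph pp; have dh := is_pol_dev ph pp.
rewrite (Val_lin u P_distr delta01 i dnu ph) (Val_lin u P_distr delta01 i dnu dh).
rewrite /Phimu -!sumrB -[alpha]mul1r -dnu.2 mulr_suml -sumrB.
apply: ler_sum => s _; rewrite -!mulrBr ler_wpM2l ?dnu.1//.
have := pot s i h p ph pp; rewrite ler_norml => /andP[+ _].
lra.
Qed.

Lemma potential_improvement nu : is_alpha_potential P delta u alpha Phi ->
  is_distr nu ->
  total_move nu <= eta * (Phimu Phi nu pi' - Phimu Phi nu pi + #|I|%:R * alpha
    + 2 * #|I|%:R ^+ 2 * (eta * (Abar A)%:R) ^+ 2 / (1 - delta) ^+ 5).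
Proof.
move=> pot dnu.
(* [eps] bounds the l1 move of one player in a state, and [e] the sum of these moves over all
   players. *)
pose eps := eta * (Abar A)%:R / (1 - delta).
have eps0 : 0 <= eps by rewrite divr_ge0 ?mulr_ge0// ltW.
pose e := #|I|%:R * eps.
have e0 : 0 <= e by rewrite mulr_ge0.
pose c i := alpha + 2 * eps * e / (1 - delta) ^+ 3
  - eta^-1 * \sum_s docc P delta nu (dev pi (pi' i)) s * sqr_move i s.
(* [hybrid_le] bounds increments from above, whereas the increase of [Phimu] is needed from below;
   hence the sign. *)
have := @hybrid_le R I (fun i => S -> A i -> R) (fun h => - Phimu Phi nu h) c pi' pi.
have -> : \sum_i c i = #|I|%:R * (alpha + 2 * eps * e / (1 - delta) ^+ 3)
    - eta^-1 * total_move nu.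
  by rewrite /c sumrB sumr_const [in RHS]mulr_natl /total_move mulr_sumr.
move=> H; have {}H : - Phimu Phi nu pi' - - Phimu Phi nu pi <=
    #|I|%:R * (alpha + 2 * eps * e / (1 - delta) ^+ 3) - eta^-1 * total_move nu.
  apply: H => h i hyb hi; rewrite -/(dev h (pi' i)).
  have ph : is_pol h by move=> j; case: (hyb j) => ->.
  have dpi := is_pol_dev ppi (ppi' i); have dh := is_pol_dev ph (ppi' i).
  have P1 := Phimu_dev pot dnu ph (ppi' i).
  have P2 : `|(Val P delta u i nu (dev h (pi' i)) - Val P delta u i nu h)
      - (Val P delta u i nu (dev pi (pi' i)) - Val P delta u i nu pi)|
      <= 2 * eps * e / (1 - delta) ^+ 3.
    rewrite !Val_dval//; apply: second_difference => //.
    - by move=> s a; case/andP: (u01 i s a) => ? ?; rewrite ger0_norm.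
    - by move=> s; exact: policy_l1_move.
    move=> s; rewrite /e mulr_natl -sumr_const; apply: ler_sum => j _.
    case: (hyb j) => ->; first exact: policy_l1_move.
    by rewrite big1// => x _; rewrite subrr normr0.
  have P3 : eta^-1 * \sum_s docc P delta nu (dev pi (pi' i)) s * sqr_move i s <=
      Val P delta u i nu (dev pi (pi' i)) - Val P delta u i nu pi.
    rewrite Val_dev// mulr_sumr; apply: ler_sum => s _.
    rewrite mulrCA ler_wpM2l ?docc_ge0// mulrC ler_pdivrMr// mulrC.
    exact: (proj_step_sqr_le (ppi i s) (step i s)).
  move: P2; rewrite ler_norml => /andP[P2 _]; rewrite /c; lra.
have -> : 2 * #|I|%:R ^+ 2 * (eta * (Abar A)%:R) ^+ 2 / (1 - delta) ^+ 5 =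
    #|I|%:R * (2 * eps * e / (1 - delta) ^+ 3).
  by rewrite /e /eps; field; rewrite gt_eqF.
by rewrite -ler_pdivrMl//; lra.
Qed.

(** [proj_step_gap] in each state, then a change of measure: the occupancy from [mu] is at most
    [k / (1 - delta)] times [nu], and by [docc_ge] [nu] is at most the occupancy occurring in
    [total_move]. *)
Lemma regret_step mu nu (k lambda : R) i (p : S -> A i -> R) :
  is_distr mu -> is_distr nu -> is_pol_i p -> 0 < lambda -> 0 <= k ->
  eta * (Abar A)%:R <= 1 - delta ->
  (forall s, occ P delta mu (dev pi p) s <= k * nu s) ->
  Val P delta u i mu (dev pi p) - Val P delta u i mu pi
  <= 3 / (2 * eta * (1 - delta)) * (lambda + k / lambda * total_move nu).
Proof.
move=> dmu dnu pp l0 k0 small hk; rewrite Val_dev//.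
have dpi := is_pol_dev ppi (ppi' i); have dp := is_pol_dev ppi pp.
apply: (@le_trans _ _ (\sum_s docc P delta mu (dev pi p) s *
    (eta^-1 * (3 / 2 * (lambda + sqr_move i s / lambda))))).
  apply: ler_sum => s _; rewrite ler_wpM2l ?docc_ge0// ler_pdivlMl//.
  apply: (proj_step_gap eta0 (ppi i s) (step i s) (pp s) M0) => // [x|].
    exact: Qf_bound.
  rewrite ler_pdivrMr// mul1r; apply: le_trans small.
  by rewrite ler_wpM2l// card_le_Abar.
have -> : \sum_s docc P delta mu (dev pi p) s *
    (eta^-1 * (3 / 2 * (lambda + sqr_move i s / lambda))) =
  3 / (2 * eta) * (lambda * \sum_s docc P delta mu (dev pi p) s +
    lambda^-1 * \sum_s docc P delta mu (dev pi p) s * sqr_move i s).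
  rewrite !mulr_sumr -big_split/= mulr_sumr; apply: eq_bigr => s _.
  by field; rewrite !gt_eqF.
rewrite docc_sum//.
have H : \sum_s docc P delta mu (dev pi p) s * sqr_move i s <=
    k / (1 - delta) * total_move nu.
  apply: (@le_trans _ _ (k / (1 - delta) *
      \sum_s docc P delta nu (dev pi (pi' i)) s * sqr_move i s)).
    rewrite mulr_sumr; apply: ler_sum => s _; rewrite mulrA ler_wpM2r//.
    have : docc P delta mu (dev pi p) s <= k / (1 - delta) * nu s.
      by rewrite mulrAC ler_pdivlMr// mulrC; exact: hk.
    move=> /le_trans; apply; apply: ler_wpM2l; first by rewrite divr_ge0// ltW.
    exact: docc_ge.
  rewrite ler_wpM2l ?divr_ge0// ?(ltW delta1)//.
  rewrite /total_move (bigD1 i)//= lerDl; apply: sumr_ge0 => j _.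
  apply: sumr_ge0 => s _; rewrite mulr_ge0 ?docc_ge0//; exact: is_pol_dev.
have -> : 3 / (2 * eta * (1 - delta)) * (lambda + k / lambda * total_move nu) =
  3 / (2 * eta) * (lambda * (1 - delta)^-1 +
    lambda^-1 * (k / (1 - delta) * total_move nu)).
  by field; rewrite !gt_eqF.
rewrite ler_wpM2l ?divr_ge0 ?mulr_ge0// lerD2l ler_wpM2l// invr_ge0; exact: ltW.
Qed.

End PolicyStep.

(** * The distribution mismatch coefficient *)

Section MismatchCoefficient.
Variables (R : realType) (S : finType).
Implicit Types d nu : S -> R.

Lemma ratio_inf_norm_le d nu (k : R) : is_distr nu ->
  (ratio_inf_norm d nu <= k%:E)%E -> forall s, d s <= k * nu s.
Proof.
move=> [nu0 _] hk s.
have := le_trans (le_bigmax 0%E (fun s => if nu s == 0 then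
  (if d s == 0 then 0%E else +oo%E) else (d s / nu s)%:E) s) hk.
(* Where [nu] vanishes, a finite ratio forces [d s = 0]. *)
have [->|nus] := eqVneq (nu s) 0.
  by rewrite mulr0; have [->//|_] := eqVneq (d s) 0; rewrite leye_eq.
by rewrite lee_fin ler_pdivrMr// lt_def nus nu0.
Qed.

(** If [d <= k * nu] pointwise, summing over the states yields [1 <= k]. *)
Lemma ratio_inf_norm_ge1 d nu : is_distr nu -> \sum_s d s = 1 ->
  (1 <= ratio_inf_norm d nu)%E.
Proof.
move=> dnu d1.
have H (k : R) : (ratio_inf_norm d nu <= k%:E)%E -> 1 <= k.
  move=> /(ratio_inf_norm_le dnu) hk; rewrite -d1 -[k]mulr1 -dnu.2 mulr_sumr.
  exact: ler_sum.
case E : (ratio_inf_norm d nu) H => [r| |] H; rewrite ?leey//.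
- by rewrite lee_fin; apply: H.
- by have := H 0 (leNye _); rewrite ler10.
Qed.

Variables (I : finType) (A : I -> finType).
Variables (P : S -> jact A -> S -> R) (delta : R) (mu : S -> R).
Hypothesis P_distr : forall s a, is_distr (P s a).
Hypothesis delta01 : 0 < delta < 1.
Hypothesis mu_distr : is_distr mu.

Lemma occ_sum (pi : pol R S A) : is_pol pi -> \sum_s occ P delta mu pi s = 1.
Proof.
move=> ppi; transitivity ((1 - delta) * \sum_s docc P delta mu pi s).
  by rewrite mulr_sumr.
by rewrite docc_sum// divff// gt_eqF// subr_gt0; case/andP: delta01.
Qed.

Lemma kappa_tilde_ge1 (pi : pol R S A) : is_pol pi ->
  (1 <= kappa_tilde P delta mu)%E.
Proof.
move=> ppi; apply: le_ereal_inf_tmp => _ [nu dnu <-].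
apply: le_trans (ratio_inf_norm_ge1 dnu (occ_sum ppi)) _.
by apply: ereal_sup_ubound; exists pi.
Qed.

(** Twice the coefficient lies strictly above the infimum because the coefficient is at least 1; the
    factor 2 thus avoids showing that the minimum is attained. *)
Lemma kappa_tilde_witness (pi0 : pol R S A) : is_pol pi0 ->
  (kappa_tilde P delta mu < +oo)%E ->
  exists nu, is_distr nu /\ forall pi : pol R S A, is_pol pi ->
    forall s, occ P delta mu pi s <= 2 * fine (kappa_tilde P delta mu) * nu s.
Proof.
move=> ppi0 kfin; have k1 := kappa_tilde_ge1 ppi0.
have [r kr] : exists r, kappa_tilde P delta mu = r%:E.
  by move: kfin k1; case: kappa_tilde => // r _ _; exists r.
have r1 : 1 <= r by rewrite -lee_fin -kr.
have : (kappa_tilde P delta mu < (2 * r)%:E)%E by rewrite kr lte_fin; lra.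
move=> /ereal_inf_lt[_ [nu dnu <-]] hsup; exists nu; split=> // pi ppi.
rewrite kr; apply: ratio_inf_norm_le => //; apply: le_trans (ltW hsup).
by apply: ereal_sup_ubound; exists pi.
Qed.

End MismatchCoefficient.

(** * Nash-regret over a whole run *)

Lemma nash_regret_le (R : realType) (I S : finType) (A : I -> finType)
    (P : S -> jact A -> S -> R) (delta : R) (u : I -> S -> jact A -> R)
    (mu : S -> R) (pit : nat -> pol R S A) (T : nat) (B : nat -> R) :
  (forall t, is_pol (pit t)) -> (forall t, 0 <= B t) ->
  (forall t i (p : S -> A i -> R), is_pol_i p ->
    Val P delta u i mu (dev (pit t) p) - Val P delta u i mu (pit t) <= B t) ->
  nash_regret P delta u mu pit T <= T%:R^-1 * \sum_(1 <= t < T.+1) B t.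
Proof.
move=> ppit B0 hB; rewrite /nash_regret ler_wpM2l ?invr_ge0//.
(* The maximum over players starts from 0, hence the condition on [B]; the current policy shows that
   the set under [sup] is nonempty. *)
apply: ler_sum => t _; apply: bigmax_le => [//|i _].
rewrite lerBlDr; apply: ge_sup.
  by exists (Val P delta u i mu (dev (pit t) (pit t i))), (pit t i) => //; exact: ppit.
by move=> _ [p pp <-]; rewrite -lerBlDr; exact: hB.
Qed.

Section ProjectedGradientAscent.
Variables (R : realType) (I S : finType) (A : I -> finType).
Variables (P : S -> jact A -> S -> R) (delta : R) (u : I -> S -> jact A -> R).
Variables (alpha : R) (Phi : S -> pol R S A -> R) (mu nu : S -> R) (C : R).
Variables (T : nat) (eta : R) (pit : nat -> pol R S A).
Hypothesis A_gt0 : forall i, (0 < #|A i|)%N.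
Hypothesis P_distr : forall s a, is_distr (P s a).
Hypothesis delta01 : 0 < delta < 1.
Hypothesis u01 : forall i s a, 0 <= u i s a <= 1.
Hypothesis pot : is_alpha_potential P delta u alpha Phi.
Hypothesis mu_distr : is_distr mu.
Hypothesis nu_distr : is_distr nu.
Hypothesis Phi_C : forall pi pi' : pol R S A, is_pol pi -> is_pol pi' ->
  `|Phimu Phi nu pi - Phimu Phi nu pi'| <= C.
Hypothesis T_gt0 : (0 < T)%N.
Hypothesis pga : is_PGA P delta u eta pit.

Let delta1 : 0 < 1 - delta. Proof. by case/andP: delta01 => _; rewrite subr_gt0. Qed.

Lemma PGA_pol t : is_pol (pit t).
Proof.
case: t => [|t] i s; last by case: (pga.2 t i s).
split=> [x|]; first by rewrite pga.1 divr_ge0.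
under eq_bigr do rewrite pga.1.
by rewrite sumr_const -[_ *+ _]mulr_natl mulrCA divff ?mulr1// pnatr_eq0 -lt0n.
Qed.

Lemma PGA_regret_trivial : nash_regret P delta u mu pit T <= (1 - delta)^-1.
Proof.
have M0 : 0 <= (1 - delta)^-1 by rewrite invr_ge0 ltW.
apply: le_trans (nash_regret_le T (B := fun=> (1 - delta)^-1) PGA_pol _ _) _ => //.
  move=> t i p pp.
  have := Val_itv P_distr delta01 u01 i mu_distr (is_pol_dev (PGA_pol t) pp).
  have := Val_itv P_distr delta01 u01 i mu_distr (PGA_pol t).
  by move=> /andP[? _] /andP[_ ?]; lra.
rewrite sumr_const_nat subSS subn0 -[X in _ * X]mulr_natl mulrA mulVf ?mul1r//.
by rewrite pnatr_eq0 -lt0n.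
Qed.

Lemma PGA_regret (k lambda : R) : 0 < eta -> 0 < lambda -> 0 <= k ->
  eta * (Abar A)%:R <= 1 - delta ->
  (forall pi : pol R S A, is_pol pi ->
    forall s, occ P delta mu pi s <= k * nu s) ->
  nash_regret P delta u mu pit T <=
  3 / (2 * eta * (1 - delta)) * (lambda + k / lambda * (eta *
    (C / T%:R + #|I|%:R * alpha +
     2 * #|I|%:R ^+ 2 * (eta * (Abar A)%:R) ^+ 2 / (1 - delta) ^+ 5))).
Proof.
move=> eta0 l0 k0 small hk.
have T0 : 0 < T%:R :> R by rewrite ltr0n.
pose D t := total_move P delta (pit t) (pit t.+1) nu.
pose c := 3 / (2 * eta * (1 - delta)).
have c0 : 0 <= c by rewrite divr_ge0// !mulr_ge0// ltW.
have kl0 : 0 <= k / lambda by rewrite divr_ge0// ltW.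
have D0 t : 0 <= D t.
  apply: sumr_ge0 => i _; apply: sumr_ge0 => s _; rewrite mulr_ge0//.
    by apply: docc_ge0 => //; apply: is_pol_dev; exact: PGA_pol.
  by apply: sumr_ge0 => x _; exact: sqr_ge0.
rewrite -(addrA (C / _)); set E := #|I|%:R * alpha + _.
apply: le_trans (nash_regret_le T (B := fun t => c * (lambda + k / lambda * D t))
  PGA_pol _ _) _.
- move=> t; apply: mulr_ge0 => //; apply: addr_ge0; first exact: ltW.
  exact: mulr_ge0.
- move=> t i p pp; apply: regret_step => //; first exact: PGA_pol.
    exact: pga.2.
  by apply: hk; apply: is_pol_dev => //; exact: PGA_pol.
rewrite -mulr_sumr mulrCA ler_wpM2l// big_split/= sumr_const_nat subSS subn0.
rewrite -mulr_sumr ler_pdivrMl// mulrDr mulr_natl lerD2l mulrCA ler_wpM2l//.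
apply: (@le_trans _ _ (\sum_(1 <= t < T.+1)
    eta * ((Phimu Phi nu (pit t.+1) - Phimu Phi nu (pit t)) + E))).
  apply: ler_sum => t _; rewrite addrA; apply: potential_improvement => //.
    exact: PGA_pol.
  exact: pga.2.
rewrite -mulr_sumr mulrCA ler_wpM2l ?(ltW eta0)// big_split/=.
(* The sum runs over 1 to [T], so it telescopes to the potentials at [T.+1] and 1, which differ by
   at most [C]. *)
rewrite (telescope_sumr (fun t => Phimu Phi nu (pit t)))// sumr_const_nat subSS subn0.
rewrite -[E *+ T]mulr_natl [leRHS]mulrDr; apply: lerD => //.
rewrite mulrC divfK ?gt_eqF//; apply: le_trans (ler_norm _) _.
by apply: Phi_C; exact: PGA_pol.
Qed.

End ProjectedGradientAscent.

(** * Choice of parameters and conclusion *)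

Lemma powR_quarters (R : realType) (x : R) (n : nat) :
  x `^ (n%:R / 4) = (x `^ (1 / 4)) ^+ n.
Proof.
by rewrite -powR_mulrn ?powR_ge0// -powRrM mul1r mulrC.
Qed.

Theorem theorem1 (R : realType) :
  exists c : R, 0 < c /\
  forall (I S : finType) (A : I -> finType)
    (P : S -> jact A -> S -> R) (delta : R)
    (u : I -> S -> jact A -> R) (alpha : R) (Phi : S -> pol R S A -> R)
    (mu : S -> R) (C_Phi : R) (T : nat) (pit : nat -> pol R S A),
    (* finite action sets are nonempty *)
    (forall i, (0 < #|A i|)%N) ->
    (* transition kernel *)
    (forall s a, is_distr (P s a)) ->
    0 < delta < 1 ->
    (* stage payoffs in [0,1] *)
    (forall i s a, 0 <= u i s a <= 1) ->
    (* Markov alpha-potential game with alpha-potential Phi *)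
    is_alpha_potential P delta u alpha Phi ->
    is_distr mu ->
    0 < C_Phi ->
    (forall (mu' : S -> R) (pi pi' : pol R S A), is_distr mu' ->
       is_pol pi -> is_pol pi' -> `| Phimu Phi mu' pi - Phimu Phi mu' pi' | <= C_Phi) ->
    (kappa_tilde P delta mu < +oo)%E ->
    (0 < T)%N ->
    is_PGA P delta u
      ((1 - delta) `^ (5 / 2) * Num.sqrt (C_Phi + (#|I|%:R) ^+ 2 * alpha * T%:R)
       / (2 * #|I|%:R * (Abar A)%:R * Num.sqrt T%:R))
      pit ->
    nash_regret P delta u mu pit T
      <= c * (Num.sqrt (fine (kappa_tilde P delta mu) * (Abar A)%:R * #|I|%:R)
              / (1 - delta) `^ (9 / 4))
           * (C_Phi / T%:R + (#|I|%:R) ^+ 2 * alpha) `^ (1 / 4).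
Proof.
(* The product of 3/2 from [proj_step_gap], 1 + 3/2 from the balanced terms and 2 from the
   denominator of [eta]. *)
exists (15 / 2); split; first by rewrite divr_gt0.
move=> I S A P delta u alpha Phi mu C T pit A0 dP d01 u01 pot dmu C0 hC kfin T0 pga.
have [delta0 delta1] := andP d01.
have d1 : 0 < 1 - delta by lra.
have ppit t : is_pol (pit t) := PGA_pol A0 pga t.
set kap := fine _; set Z := C / T%:R + _.
(* Without players every maximum is its default 0, so the regret is at most 0. *)
have [/card0_eq I0|I_gt0] := posnP #|I|.
  apply: (@le_trans _ _ 0).
    apply: le_trans (nash_regret_le T (B := fun=> 0) ppit _ _) _ => //.
      by move=> t i; move: (I0 i).
    by rewrite big1 ?mulr0.
  by rewrite !mulr_ge0 ?invr_ge0 ?powR_ge0 ?sqrtr_ge0.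
have [i0 _] := card_gt0P I_gt0.
have [s0 _] : exists s : S, true.
  have [//|] := pselect (exists s : S, true) => nS; have [_] := dmu.
  rewrite big1 => [|s _]; last by case: nS; exists s.
  by move=> /esym/eqP; rewrite oner_eq0.
have alpha0 : 0 <= alpha.
  exact: le_trans (normr_ge0 _) (pot s0 i0 _ _ (ppit 0%N) (ppit 0%N i0)).
have N1 : 1 <= #|I|%:R :> R by rewrite ler1n.
have A1 : 1 <= (Abar A)%:R :> R.
  by apply: le_trans (card_le_Abar R A i0); rewrite ler1n.
have T0' : 0 < T%:R :> R by rewrite ltr0n.
have Z0 : 0 < Z by rewrite ltr_wpDr ?divr_gt0// mulr_ge0// exprn_ge0.
have kap1 : 1 <= kap.
  have := kappa_tilde_ge1 dP d01 dmu (ppit 0%N); move: kfin; rewrite /kap.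
  by case: kappa_tilde => //= r _; rewrite lee_fin.
have [nu [dnu hnu]] := kappa_tilde_witness dP d01 dmu (ppit 0%N) kfin.
rewrite -/kap in hnu.
set N : R := #|I|%:R in N1 Z Z0 *; set Ab : R := (Abar A)%:R in A1 *.
(* All quantities are integer powers of [b] and [w]. *)
pose b := (1 - delta) `^ (1 / 4); pose w := Z `^ (1 / 4).
pose m := Num.sqrt (kap * Ab * N).
have b0 : 0 < b by rewrite powR_gt0.
have w0 : 0 < w by rewrite powR_gt0.
have b4 : 1 - delta = b ^+ 4.
  by rewrite -powR_quarters divff// powRr1// ltW.
have w4 : Z = w ^+ 4 by rewrite -powR_quarters divff// powRr1// ltW.
have b10 : (1 - delta) `^ (5 / 2) = b ^+ 10.
  by rewrite -powR_quarters; congr (_ `^ _); field.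
have b9 : (1 - delta) `^ (9 / 4) = b ^+ 9 by rewrite -powR_quarters.
have b1 : b <= 1.
  by rewrite -(@expr_le1 _ 4)// ?(ltW b0)// -b4; lra.
have kAN1 : 1 <= kap * Ab * N by rewrite !mulr_ege1.
have m2 : m ^+ 2 = kap * Ab * N by rewrite sqr_sqrtr//; lra.
have m1 : 1 <= m by rewrite -sqrtr1 ler_wsqrtr.
pose eta := b ^+ 10 * w ^+ 2 / (2 * N * Ab).
have eta_gt0 : 0 < eta by rewrite divr_gt0 ?mulr_gt0 ?exprn_gt0//; lra.
have etaE : (1 - delta) `^ (5 / 2) * Num.sqrt (C + N ^+ 2 * alpha * T%:R)
    / (2 * N * Ab * Num.sqrt T%:R) = eta.
  have -> : C + N ^+ 2 * alpha * T%:R = (w ^+ 2) ^+ 2 * T%:R.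
    by rewrite -exprM -w4 /Z; field; rewrite gt_eqF.
  rewrite sqrtrM ?sqr_ge0// sqrtr_sqr ger0_norm ?sqr_ge0// b10 /eta.
  by field; rewrite ?sqrtr_eq0 -?ltNge T0' !gt_eqF//; lra.
rewrite etaE in pga.
rewrite -/m -/w b9.
have [small|large] := lerP (eta * Ab) (1 - delta).
  (* [lambda ^+ 2 = 2 * kap * eta * Z] balances the two terms of [PGA_regret]. *)
  pose lambda := b ^+ 5 * w ^+ 3 * m / (N * Ab).
  have l0 : 0 < lambda.
    by rewrite divr_gt0 ?mulr_gt0 ?exprn_gt0//; lra.
  have PhiC pi pi' : is_pol pi -> is_pol pi' ->
    `|Phimu Phi nu pi - Phimu Phi nu pi'| <= C by exact: hC.
  have k0 : 0 <= 2 * kap by lra.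
  apply: le_trans (PGA_regret A0 dP d01 u01 pot dmu dnu PhiC T0 pga
    eta_gt0 l0 k0 small hnu) _.
  (* The step size makes the second-order error exactly [Z / 2], and [N * alpha <= N ^+ 2 * alpha]
     puts the rest below [Z]. *)
  apply: (@le_trans _ _ (3 / (2 * eta * (1 - delta)) *
      (lambda + 2 * kap / lambda * (eta * (3 / 2 * Z))))).
    apply: ler_wpM2l.
      by apply: divr_ge0 => //; do 2?[apply: mulr_ge0 => //]; exact: ltW.
    rewrite lerD2l; apply: ler_wpM2l; first by rewrite divr_ge0// ltW.
    apply: ler_wpM2l; first exact: ltW.
    have -> : 2 * N ^+ 2 * (eta * Ab) ^+ 2 / (1 - delta) ^+ 5 = Z / 2.
      by rewrite /eta b4 w4; field; rewrite !gt_eqF//; lra.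
    have : N * alpha <= N ^+ 2 * alpha by rewrite ler_wpM2r// expr2 ler_peMl//; lra.
    rewrite /Z; lra.
  have -> : 2 * kap / lambda * (eta * (3 / 2 * Z)) = 3 / 2 * lambda.
    have -> : kap = m ^+ 2 / (Ab * N) by rewrite m2; field; rewrite !gt_eqF//; lra.
    by rewrite /lambda /eta w4; field; rewrite !gt_eqF//; lra.
  rewrite b4 le_eqVlt; apply/orP; left; apply/eqP.
  by rewrite /lambda /eta; field; rewrite !gt_eqF//; lra.
(* For a large step the claimed bound already exceeds [(1 - delta)^-1]. *)
apply: le_trans (PGA_regret_trivial A0 dP d01 u01 dmu T0 pga) _.
(* Here [eta * Ab] equals [b ^+ 4 * (b ^+ 3 * w) ^+ 2 / (2 * N)]; if it exceeds [b ^+ 4], then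
   [b ^+ 3 * w] cannot be below 1. *)
have bw : 1 <= b ^+ 3 * w.
  rewrite leNgt; apply/negP => bw1.
  have bw2 : (b ^+ 3 * w) ^+ 2 < 1 by rewrite expr_lt1// mulr_ge0 ?exprn_ge0// ltW.
  move: large; rewrite b4 (_ : eta * Ab = b ^+ 4 * ((b ^+ 3 * w) ^+ 2 / (2 * N))).
    rewrite -[X in X < _]mulr1 ltr_pM2l ?exprn_gt0// ltr_pdivlMr; lra.
  by rewrite /eta; field; rewrite !gt_eqF//; lra.
have b9_gt0 : 0 < b ^+ 9 by rewrite exprn_gt0.
have b4_gt0 : 0 < b ^+ 4 by rewrite exprn_gt0.
rewrite mulrA mulrAC ler_pdivlMr// b4.
rewrite (_ : (b ^+ 4)^-1 * b ^+ 9 = b ^+ 5); last by field; rewrite gt_eqF.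
have b5 : b ^+ 5 <= 1 by rewrite exprn_ile1// ltW.
have b3 : b ^+ 3 <= 1 by rewrite exprn_ile1// ltW.
have w1 : 1 <= w.
  by apply: le_trans bw _; rewrite ler_piMl// ltW.
have mw1 : 1 <= m * w by rewrite mulr_ege1.
by rewrite -mulrA; lra.
Qed.
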